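(* Let $k$ be a field of characteristic zero and let $\mathfrak{g}$ be the $3$-step nilpotent Lie algebra over $k$ on $4$ generators, of dimension $13$, with basis $(x_1,\ldots,x_{13})$ and non-trivial Lie brackets (up to antisymmetry) $$\begin{aligned} &[x_1,x_2]=x_5,\quad [x_1,x_4]=x_6,\quad [x_1,x_6]=x_{10},\quad [x_1,x_7]=x_{11},\quad [x_1,x_8]=x_{12},\\ &[x_2,x_3]=x_7,\quad [x_2,x_4]=x_8,\quad [x_2,x_5]=x_{13},\quad [x_2,x_7]=x_{13},\\ &[x_3,x_4]=-x_5,\quad [x_3,x_5]=-x_{11},\quad [x_3,x_8]=x_9,\\ &[x_4,x_5]=-x_{12},\quad [x_4,x_6]=x_9,\quad [x_4,x_7]=x_9+x_{13}. \end{aligned}$$ This $2$-step solvable Lie algebra does not admit an LR-structure.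
   Context: An LR-structure on a Lie algebra $\mathfrak{g}$ over $k$ is a bilinear product $\mathfrak{g}\times\mathfrak{g}\to\mathfrak{g}$, $(x,y)\mapsto x\cdot y$, satisfying for all $x,y,z\in\mathfrak{g}$: $x\cdot(y\cdot z)=y\cdot(x\cdot z)$, $(x\cdot y)\cdot z=(x\cdot z)\cdot y$, and $[x,y]=x\cdot y-y\cdot x$. A Lie algebra $\mathfrak{g}$ is $2$-step solvable if $[[\mathfrak{g},\mathfrak{g}],[\mathfrak{g},\mathfrak{g}]]=0$. *)

(* Defs.v *)
From HB Require Import structures.
From mathcomp Require Import all_boot all_algebra ring.

Set Implicit Arguments.
Unset Strict Implicit.
Unset Printing Implicit Defensive.

Import GRing.Theory.
Local Open Scope ring_scope.

HB.mixin Record isLieAlgebra (k : fieldType) g of Vector k g := {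
  bracket : g -> g -> g;
  bracket_bilinear : bilinear_for *:%R *:%R bracket;
  bracketxx : forall x, bracket x x = 0;
  bracket_jacobi : forall x y z,
    bracket x (bracket y z) + bracket y (bracket z x) + bracket z (bracket x y)
      = 0
}.

(* Finite-dimensional Lie algebras over the field k. *)
#[short(type="lieAlgType")]
HB.structure Definition LieAlgebra (k : fieldType) :=
  {g of Vector k g & isLieAlgebra k g}.

Definition is_LR_structure (k : fieldType) (g : lieAlgType k)
    (m : {bilinear g -> g -> g}) : Prop :=
  [/\ forall x y z, m x (m y z) = m y (m x z),
      forall x y z, m (m x y) z = m (m x z) y
    & forall x y, bracket x y = m x y - m y x].

Definition admits_LR_structure (k : fieldType) (g : lieAlgType k) : Prop :=
  exists m : {bilinear g -> g -> g}, is_LR_structure m.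

(* [U, V] is the span of all [u, v] with u in U and v in V; by bilinearity it
   is enough to let u and v range over bases of U and V. *)
Definition bracketv (k : fieldType) (g : lieAlgType k) (U V : {vspace g}) :
    {vspace g} :=
  <<[seq bracket u v | u <- vbasis U, v <- vbasis V]>>%VS.

(* The indexing starts at 0: lower_central g 0 = g. *)
Fixpoint lower_central (k : fieldType) (g : lieAlgType k) (n : nat) :
    {vspace g} :=
  if n is n'.+1 then bracketv fullv (lower_central g n') else fullv.

(* n-step nilpotent: nilpotent of class exactly n. *)
Definition step_nilpotent (k : fieldType) (g : lieAlgType k) (n : nat) : Prop :=
  lower_central g n = 0%VS /\
  forall m, (m < n)%N -> lower_central g m <> 0%VS.

Definition two_step_solvable (k : fieldType) (g : lieAlgType k) : Prop :=
  bracketv (bracketv (@fullv k g) fullv) (bracketv fullv fullv) = 0%VS.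

Definition lie_generates (k : fieldType) (g : lieAlgType k) (s : seq g) : Prop :=
  forall U : {vspace g}, (bracketv U U <= U)%VS -> {subset s <= U} ->
  U = fullv.

(* On n generators: n is the least size of a generating family. *)
Definition on_generators (k : fieldType) (g : lieAlgType k) (n : nat) : Prop :=
  (exists2 s : seq g, size s = n & lie_generates s) /\
  (forall s : seq g, lie_generates s -> (n <= size s)%N).

(* The value of [x_i, x_j] for i < j, with indices starting at 1. *)
Definition bracket_table (k : fieldType) (g : lieAlgType k) (x : nat -> g)
    (i j : nat) : g :=
  match i, j with
  | 1, 2 => x 5
  | 1, 4 => x 6
  | 1, 6 => x 10
  | 1, 7 => x 11
  | 1, 8 => x 12
  | 2, 3 => x 7
  | 2, 4 => x 8
  | 2, 5 => x 13
  | 2, 7 => x 13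
  | 3, 4 => - x 5
  | 3, 5 => - x 11
  | 3, 8 => x 9
  | 4, 5 => - x 12
  | 4, 6 => x 9
  | 4, 7 => (x 9 + x 13)%R
  | _, _ => 0%R
  end%N.

(* The 0-based tuple X is (x_1, ..., x_13), so x_i is the entry i - 1 of X. *)
Definition has_bracket_table (k : fieldType) (g : lieAlgType k)
    (X : 13.-tuple g) : Prop :=
  let x i := X`_i.-1 in
  basis_of fullv X /\
  forall i j, (1 <= i < j)%N -> (j <= 13)%N ->
    bracket (x i) (x j) = bracket_table x i j.

(* A model: the table does satisfy the Jacobi identity. *)
Definition g13 (k : fieldType) : Type := 'rV[k]_13.
HB.instance Definition _ (k : fieldType) := Vector.on (g13 k).

(* With 1-based indices, g13_minor u v i j = u_i v_j - u_j v_i. *)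
Definition g13_minor (k : fieldType) (u v : g13 k) (i j : nat) : k :=
  u 0 (inord i.-1) * v 0 (inord j.-1) - u 0 (inord j.-1) * v 0 (inord i.-1).

Definition g13_coord (k : fieldType) (u v : g13 k) : seq k :=
  [:: 0; 0; 0; 0;
    g13_minor u v 1 2 - g13_minor u v 3 4; g13_minor u v 1 4;
    g13_minor u v 2 3; g13_minor u v 2 4;
    g13_minor u v 3 8 + g13_minor u v 4 6 + g13_minor u v 4 7;
    g13_minor u v 1 6;
    g13_minor u v 1 7 - g13_minor u v 3 5;
    g13_minor u v 1 8 - g13_minor u v 4 5;
    g13_minor u v 2 5 + g13_minor u v 2 7 + g13_minor u v 4 7].

Definition g13_bracket (k : fieldType) (u v : g13 k) : g13 k :=
  \row_(l < 13) (g13_coord u v)`_l.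

Lemma g13_bracketE (k : fieldType) (u v : g13 k) (l : nat) : (l < 13)%N ->
  g13_bracket u v 0 (inord l) = (g13_coord u v)`_l.
Proof. by move=> Hl; rewrite mxE inordK. Qed.

Lemma g13_eqP (k : fieldType) (u v : g13 k) :
  (forall l, (l < 13)%N -> u 0 (inord l) = v 0 (inord l)) -> u = v.
Proof.
by move=> E; apply/rowP => l; have := E l (ltn_ord l); rewrite inord_val.
Qed.

Lemma g13_linE (k : fieldType) (a : k) (u v : g13 k) i :
  (a *: u + v) 0 i = a * u 0 i + v 0 i.
Proof. by rewrite !mxE. Qed.

Lemma g13_bracket_bilinear (k : fieldType) :
  bilinear_for *:%R *:%R (@g13_bracket k).
Proof.
split=> w a u v; apply: g13_eqP => l Hl; rewrite g13_linE !g13_bracketE //;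
  rewrite /= /g13_coord /g13_minor !g13_linE; move: l Hl;
  do 13?[case=> [_ /=|]; [by ring|]]; by [].
Qed.

Lemma g13_bracketxx (k : fieldType) (u : g13 k) : g13_bracket u u = 0.
Proof.
apply: g13_eqP => l Hl; rewrite g13_bracketE // [RHS]mxE /g13_coord /g13_minor.
by move: l Hl; do 13?[case=> [_ /=|]; [by ring|]].
Qed.

Lemma g13_bracket_jacobi (k : fieldType) (u v w : g13 k) :
  g13_bracket u (g13_bracket v w) + g13_bracket v (g13_bracket w u)
    + g13_bracket w (g13_bracket u v) = 0.
Proof.
have addE (a b : g13 k) i : (a + b) 0 i = a 0 i + b 0 i by rewrite mxE.
apply: g13_eqP => l Hl; rewrite [RHS]mxE !addE !g13_bracketE // /g13_coord.
move: l Hl; do 13?[case=> [_ /=|];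
  [by rewrite /g13_minor ?g13_bracketE //= /g13_minor; ring|]]; by [].
Qed.

HB.instance Definition _ (k : fieldType) :=
  isLieAlgebra.Build k (g13 k) (@g13_bracket_bilinear k)
    (@g13_bracketxx k) (@g13_bracket_jacobi k).

Definition g13_basis (k : fieldType) : 13.-tuple (g13 k) :=
  [tuple delta_mx 0 i | i < 13].

Lemma g13_minor_delta (k : fieldType) (i j a b : nat) :
  (i < 13)%N -> (j < 13)%N -> (a.-1 < 13)%N -> (b.-1 < 13)%N ->
  g13_minor (delta_mx 0 (inord i) : g13 k) (delta_mx 0 (inord j)) a b
  = ((i == a.-1) && (j == b.-1))%:R - ((i == b.-1) && (j == a.-1))%:R.
Proof.
move=> Hi Hj Ha Hb.
have deltaE p q : (p < 13)%N -> (q < 13)%N ->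
    (delta_mx 0 (inord p) : g13 k) 0 (inord q) = (p == q)%:R.
  move=> Hp Hq; rewrite mxE eqxx /=; congr (nat_of_bool _)%:R.
  by rewrite -val_eqE /= !inordK // eq_sym.
by rewrite /g13_minor !deltaE // -!natrM !mulnb.
Qed.

Lemma g13_has_bracket_table (k : fieldType) : has_bracket_table (g13_basis k).
Proof.
have bE i : (i < 13)%N -> (g13_basis k)`_i = delta_mx 0 (inord i).
  move=> Hi; rewrite -[i in LHS](inordK Hi) -tnth_nth tnth_mktuple //.
split.
  rewrite basisEfree size_tuple dimvf /dim /= mul1n leqnn andbT subvf andbT.
  apply/(@freeP _ _ 13 (g13_basis k)) => c Hc i.
  move/rowP/(_ i): Hc; rewrite summxE mxE => <-.
  rewrite (bigD1 i) //= big1 => [|j ji].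
    by rewrite addr0 bE // inord_val !mxE !eqxx mulr1.
  by rewrite bE // inord_val !mxE eqxx eq_sym (negPf ji) mulr0.
have entry p q : (p < 13)%N -> (q < 13)%N ->
    (delta_mx 0 (inord p) : g13 k) 0 (inord q) = (p == q)%:R.
  move=> Hp Hq; rewrite mxE eqxx /=; congr (nat_of_bool _)%:R.
  by rewrite -val_eqE /= !inordK // eq_sym.
have addE (a b : g13 k) i : (a + b) 0 i = a 0 i + b 0 i by rewrite mxE.
have oppE (a : g13 k) i : (- a) 0 i = - a 0 i by rewrite mxE.
have zeroE i : (0 : g13 k) 0 i = 0 by rewrite mxE.
case=> [|i] // [|j] // /andP[_ ij] jn; have ni := leq_trans (ltnW ij) jn.
rewrite /= !bE //; apply: g13_eqP => l Hl; rewrite g13_bracketE // /g13_coord.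
rewrite !g13_minor_delta //=.
move: ni ij; do 4?[case: i => [|i]].
1-4: move: jn; do 8?[case: j => [|j]] => // _ _ _; rewrite /= ?bE //;
  move: l Hl; do 13?[case=> [_ | ]];
  by rewrite ?(addE, oppE, zeroE, entry) //=
    ?(subrr, subr0, sub0r, addr0, oppr0) //; ring.
do 5?[case: j jn => [|j] jn //] => _ _; rewrite zeroE /=; move: l Hl.
by do 13?[case=> [_ | ]]; rewrite ?andbF //= ?(subrr, addr0) //; ring.
Qed.

(* Main.v *)
From HB Require Import structures.
Require Import Defs.
From mathcomp Require Import all_boot all_algebra.
From mathcomp Require Import ring.

(** The bracket is homogeneous for the grading of g by V1 = <x1, .., x4>,
    V2 = <x5, .., x8>, V3 = <x9, .., x13>, and the lower central series is the
    associated filtration, with terms spanned by the last 13, 9, 5 and 0 basis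
    vectors. Nilpotency, solvability and the number of generators are read off
    from it.

    The product of an LR-structure is governed by derivations: the two
    commutation laws make every left multiplication L_u : v |-> u . v
    a derivation of the bracket ([LR_derivation]). So the structure is a linear
    family of pairwise commuting derivations with
    L_u v - L_v u = [u, v], and g has too few derivations to allow one.

    Degree 0. The relations [x1, x3] = 0, [x1, x2] = - [x3, x4] and four cubic
    ones force a derivation to act on g / [g, g] as diag(a, b, a, b)
    ([derivation_mod_gamma2]). Modulo [g, g] the product is commutative, so for
    i != j the class of x_i . x_j is a multiple both of x_j and of x_i, hence
    zero; as the eigenvalues of L_(x_i) agree in pairs, x_i . x_i vanishes too,
    and g . g lies in [g, g] ([LR_product_in_gamma2]).

    Degree 1. The same two quadratic relations link the V2-coordinates of
    D x1, .., D x4 for a derivation D ([derivation_degree1]). Write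
    (ij)_l for the coordinate of x_i . x_j on x_l and put a = (23)_7. Going
    around the pairs (2, 3), (3, 4), (2, 4) alternately with these links and
    with the equation L_u v - L_v u = [u, v] gives a = 1 - a, and the
    pair (1, 2) gives (12)_5 = 1 - a. The coordinate on x13 of
    x1 . (x2 . x2) = x2 . (x1 . x2) then reads 0 = (12)_5 a, all other terms
    being zero ([derivation_coord13]). So 0 = (1 - a) a = a ^ 2 although
    2 a = 1. *)

Set Implicit Arguments.
Unset Strict Implicit.
Unset Printing Implicit Defensive.

Import GRing.Theory.
Local Open Scope ring_scope.

(** * Lie algebras and derivations *)

HB.instance Definition _ (k : fieldType) (g : lieAlgType k) :=
  bilinear_isBilinear.Build k g g g *:%R *:%R (@bracket k g)
    (@bracket_bilinear k g).

Section LieAlgebras.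
Variables (k : fieldType) (g : lieAlgType k).
Implicit Types (u v w : g) (U V W : {vspace g}).

Lemma bracket_skew u v : bracket u v = - bracket v u.
Proof.
have := bracketxx (u + v).
rewrite linearDl !linearDr /= !bracketxx add0r addr0.
by move/eqP; rewrite addr_eq0 => /eqP.
Qed.

Lemma memv_bracket U V u v : u \in U -> v \in V -> bracket u v \in bracketv U V.
Proof.
move=> uU vV; rewrite (coord_vbasis uU) (coord_vbasis vV) linear_sumlz.
apply: memv_suml => i _; rewrite linearZl_LR linear_sumr memvZ //.
apply: memv_suml => j _; rewrite linearZr_LR memvZ // memv_span //.
by apply: allpairs_f; rewrite mem_nth ?size_tuple.
Qed.

Lemma bracketv_sub U V W :
  (forall u v, u \in U -> v \in V -> bracket u v \in W) ->
  (bracketv U V <= W)%VS.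
Proof.
move=> UVW; apply/span_subvP => _ /allpairsP[[u v] /= [uU vV ->]].
by apply: UVW; apply: vbasis_mem.
Qed.

Definition derivation (D : g -> g) :=
  forall u v, D (bracket u v) = bracket (D u) v + bracket u (D v).

(** Expand u . [v, w] = u . (v . w) - u . (w . v). The first law moves u past
    v and w; what is missing to [u . v, w] + [v, u . w] is
    (u . v) . w - (u . w) . v, which the second law makes zero. *)
Lemma LR_derivation (m : {bilinear g -> g -> g}) :
  is_LR_structure m -> forall u, derivation (m u).
Proof.
case=> mL mR mB u v w; rewrite !mB linearB /= (mL u v) (mL u w).
by rewrite (mR u v w) [RHS]addrC [RHS]addrA subrK.
Qed.

End LieAlgebras.

(** * Coordinates *)

Lemma bracket_table_eq (k : fieldType) (g : lieAlgType k) (x y : nat -> g) :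
  x =1 y -> bracket_table x =2 bracket_table y.
Proof.
move=> xy i j.
by do 5?[case: i => [|i]]; do 9?[case: j => [|j]]; rewrite /= ?xy.
Qed.

Lemma raddf_bracket_table (k : fieldType) (g h : lieAlgType k)
  (f : {linear g -> h}) (x : nat -> g) i j :
  f (bracket_table x i j) = bracket_table (f \o x) i j.
Proof.
by do 5?[case: i => [|i]]; do 9?[case: j => [|j]];
  rewrite /= ?raddf0 ?raddfN ?raddfD.
Qed.

(** The table determines the bracket. Applied to the model g13, this turns the
    coordinate formula of the model into one for every Lie algebra with the same
    table, without expanding a double sum over the basis. *)
Lemma bracket_table_hom (k : fieldType) (g h : lieAlgType k)
  (f : {linear g -> h}) (X : 13.-tuple g) (Y : 13.-tuple h) :
  has_bracket_table X -> has_bracket_table Y -> (forall i, f X`_i = Y`_i) ->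
  forall u v, f (bracket u v) = bracket (f u) (f v).
Proof.
move=> [Xb XT] [_ YT] fXY u v.
have lt i j : (i < j)%N -> (j < 13)%N ->
    f (bracket X`_i X`_j) = bracket (f X`_i) (f X`_j).
  move=> ij jn; rewrite (XT i.+1 j.+1) // raddf_bracket_table !fXY.
  rewrite (YT i.+1 j.+1) //.
  by apply: bracket_table_eq => l /=.
have bas (i j : 'I_13) : f (bracket X`_i X`_j) = bracket (f X`_i) (f X`_j).
  case: (ltngtP i j) => ij.
  - exact: lt.
  - by rewrite bracket_skew raddfN /= lt // -bracket_skew.
  - by rewrite ij !bracketxx raddf0.
rewrite (coord_basis Xb (memvf u)) (coord_basis Xb (memvf v)).
rewrite linear_sumlz !raddf_sum /= linear_sumlz; apply: eq_bigr => i _.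
rewrite !linear_sumr !raddf_sum /=; apply: eq_bigr => j _.
by rewrite !(linearZl_LR, linearZr_LR, linearZ) /= bas.
Qed.

Section Coordinates.
Variables (k : fieldType) (g : lieAlgType k).
Variable X : 13.-tuple g.

(** The codomain is g13 k, not just row vectors, for the sake of its bracket. *)
Definition coords (u : g) : g13 k := \row_(i < 13) coord X i u.

Lemma coords_linear : linear coords.
Proof. by move=> a u v; apply/rowP => i; rewrite !mxE linearP. Qed.

HB.instance Definition _ :=
  GRing.isLinear.Build k g (g13 k) _ coords coords_linear.

(** Indices start at 1 here, to agree with the names x_1, .., x_13. *)
Definition xcoord (l : nat) (u : g) : k := coord X (inord l.-1) u.

Lemma xcoord_scalar l : scalar (xcoord l).
Proof. by move=> a u v; rewrite /xcoord linearP. Qed.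

HB.instance Definition _ l :=
  GRing.isLinear.Build k g k _ (xcoord l) (xcoord_scalar l).

Hypothesis gX : has_bracket_table X.
Let Xb : basis_of fullv X := proj1 gX.
Implicit Types (u v w : g) (i j l : nat).

Let x i := X`_i.-1.
Local Notation c := xcoord.

Lemma coord_x i j : (0 < i <= 13)%N -> (0 < j <= 13)%N ->
  c i (x j) = (i == j)%:R.
Proof.
case: i j => // i [] // j /= i13 j13.
rewrite /xcoord -[in LHS](inordK j13) coord_free ?(basis_free Xb) //.
by rewrite -val_eqE /= !inordK // eqSS eq_sym.
Qed.

Lemma coords_bracket u v : coords (bracket u v) = bracket (coords u) (coords v).
Proof.
have Xf : free X := basis_free Xb.
rewrite -[LHS]/((coords : {linear g -> g13 k}) (bracket u v)).
apply: (bracket_table_hom gX (g13_has_bracket_table k)) => i.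
have [i13 | i13] := ltnP i 13; last first.
  by rewrite !nth_default ?size_tuple // linear0.
rewrite -(inordK i13) -[RHS]tnth_nth tnth_mktuple.
by apply/rowP => l; rewrite !mxE coord_free // eq_sym.
Qed.

Definition minor u v i j : k := c i u * c j v - c j u * c i v.

Lemma coord_bracket u v :
  ((c 1 (bracket u v) = 0) *
  (c 2 (bracket u v) = 0) *
  (c 3 (bracket u v) = 0) *
  (c 4 (bracket u v) = 0) *
  (c 5 (bracket u v) = (minor u v 1 2 - minor u v 3 4)%R) *
  (c 6 (bracket u v) = (minor u v 1 4)%R) *
  (c 7 (bracket u v) = (minor u v 2 3)%R) *
  (c 8 (bracket u v) = (minor u v 2 4)%R) *
  (c 9 (bracket u v) = (minor u v 3 8 + minor u v 4 6 + minor u v 4 7)%R) *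
  (c 10 (bracket u v) = (minor u v 1 6)%R) *
  (c 11 (bracket u v) = (minor u v 1 7 - minor u v 3 5)%R) *
  (c 12 (bracket u v) = (minor u v 1 8 - minor u v 4 5)%R) *
  (c 13 (bracket u v) =
    (minor u v 2 5 + minor u v 2 7 + minor u v 4 7)%R))%type.
Proof.
have E l : (l < 13)%N -> c l.+1 (bracket u v) =
    (g13_coord (coords u) (coords v))`_l.
  by move=> l13; rewrite -g13_bracketE // -[g13_bracket _ _]coords_bracket mxE.
have M i j : g13_minor (coords u) (coords v) i j = minor u v i j.
  by rewrite /g13_minor !mxE.
do ?apply: pair; rewrite ?E //= ?M //.
Qed.

(** * Lower central series and generators *)

Lemma mem_dropP n u :
  reflect (forall l, (0 < l <= 13)%N -> (l <= n)%N -> c l u = 0)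
    (u \in <<drop n X>>%VS).
Proof.
apply: (iffP idP) => [uS l l13 ln | u0].
  rewrite (coord_span (X := in_tuple (drop n X)) uS) linear_sum big1 // => i _.
  have i13 : (n + i < 13)%N.
    have := ltn_ord i.
    by rewrite [X in (i < X)%N]size_drop size_tuple ltn_subRL.
  rewrite linearZ /= nth_drop (coord_x l13 (j := (n + i).+1)) //.
  by rewrite (ltn_eqF (leq_ltn_trans ln _)) ?mulr0 // ltnS leq_addr.
rewrite (coord_basis Xb (memvf u)); apply: memv_suml => i _.
have [ni | ni] := leqP n i.
  rewrite memvZ // memv_span // -(subnKC ni) -nth_drop mem_nth //.
  by rewrite size_drop size_tuple ltn_sub2r // (leq_ltn_trans ni).
have := u0 i.+1 (ltn_ord i) ni; rewrite /xcoord /= inord_val => ->.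
by rewrite scale0r mem0v.
Qed.

(** The inclusions between the terms of the filtration below are all instances:
    each becomes a statement on the vanishing coordinates of one bracket. *)
Lemma bracketv_drop (U V : {vspace g}) p q n :
  (U <= <<drop p X>>)%VS -> (V <= <<drop q X>>)%VS ->
  (forall u v,
     (forall l, (0 < l <= 13)%N -> (l <= p)%N -> c l u = 0) ->
     (forall l, (0 < l <= 13)%N -> (l <= q)%N -> c l v = 0) ->
   forall l, (0 < l <= 13)%N -> (l <= n)%N -> c l (bracket u v) = 0) ->
  (bracketv U V <= <<drop n X>>)%VS.
Proof.
move=> /subvP Up /subvP Vq UVn; apply: bracketv_sub.
move=> u v /Up /mem_dropP u0 /Vq /mem_dropP v0.
by apply/mem_dropP; apply: UVn.
Qed.

Lemma sub_drop0 (U : {vspace g}) : (U <= <<drop 0 X>>)%VS.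
Proof. by rewrite drop0 (span_basis Xb) subvf. Qed.

Lemma drop_all0 : <<drop 13 X>>%VS = 0%VS.
Proof. by rewrite drop_oversize ?size_tuple // span_nil. Qed.

Lemma gamma2_sub (U V : {vspace g}) : (bracketv U V <= <<drop 4 X>>)%VS.
Proof.
apply: (bracketv_drop (sub_drop0 U) (sub_drop0 V)) => u v _ _.
by case=> [|[|[|[|[|l]]]]] // _ _; rewrite coord_bracket.
Qed.

Lemma gamma3_sub (U V : {vspace g}) :
  (V <= <<drop 4 X>>)%VS -> (bracketv U V <= <<drop 8 X>>)%VS.
Proof.
move=> V4; apply: (bracketv_drop (sub_drop0 U) V4) => u v _ v0.
by case=> [|[|[|[|[|[|[|[|[|l]]]]]]]]] // _ _;
  rewrite coord_bracket /minor // !v0 //; ring.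
Qed.

Lemma gamma4_eq0 (U V : {vspace g}) :
  (V <= <<drop 8 X>>)%VS -> bracketv U V = 0%VS.
Proof.
move=> V8; apply/eqP; rewrite -subv0 -drop_all0.
apply: (bracketv_drop (sub_drop0 U) V8) => u v _ v0.
by case=> [|[|[|[|[|[|[|[|[|[|[|[|[|[|l]]]]]]]]]]]]]] // _ _;
  rewrite coord_bracket /minor // !v0 //; ring.
Qed.

Lemma bracketv_gamma2_eq0 (U V : {vspace g}) :
  (U <= <<drop 4 X>>)%VS -> (V <= <<drop 4 X>>)%VS -> bracketv U V = 0%VS.
Proof.
move=> U4 V4; apply/eqP; rewrite -subv0 -drop_all0.
apply: (bracketv_drop U4 V4) => u v u0 v0.
by case=> [|[|[|[|[|[|[|[|[|[|[|[|[|[|l]]]]]]]]]]]]]] // _ _;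
  rewrite coord_bracket /minor // ?(u0 1%N, u0 2%N, u0 3%N, u0 4%N) //
    ?(v0 1%N, v0 2%N, v0 3%N, v0 4%N) //; ring.
Qed.

Lemma two_step_solvable13 : two_step_solvable g.
Proof. exact: bracketv_gamma2_eq0 (gamma2_sub _ _) (gamma2_sub _ _). Qed.

Lemma bracket_x i j : (0 < i < j)%N -> (j <= 13)%N ->
  bracket (x i) (x j) = bracket_table x i j.
Proof. by case: gX => _; apply. Qed.

Lemma x_neq0 i : (0 < i <= 13)%N -> x i <> 0.
Proof.
move=> i13 xi0; have := coord_x i13 i13.
by rewrite -/(x i) xi0 linear0 eqxx => /esym/eqP; rewrite oner_eq0.
Qed.

Lemma step_nilpotent13 : step_nilpotent g 3.
Proof.
split=> [|m m3 mE].
  exact/gamma4_eq0/gamma3_sub/gamma2_sub.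
have x5 : x 5 \in lower_central g 1.
  have -> : x 5 = bracket (x 1) (x 2) by rewrite bracket_x.
  by rewrite memv_bracket ?memvf.
have x13 : x 13 \in lower_central g 2.
  have -> : x 13 = bracket (x 2) (x 5) by rewrite bracket_x.
  by rewrite memv_bracket ?memvf.
case: m m3 mE => [|[|[|m]]] // _ mE.
- by apply: (@x_neq0 1) => //; apply/eqP; rewrite -memv0 -mE memvf.
- by apply: (@x_neq0 5) => //; apply/eqP; rewrite -memv0 -mE.
- by apply: (@x_neq0 13) => //; apply/eqP; rewrite -memv0 -mE.
Qed.

Lemma generated4 : lie_generates (take 4 X).
Proof.
move=> U UU sU.
have xU i : (0 < i <= 4)%N -> x i \in U.
  case: i => // i i4; apply: sU; rewrite /x /= -(nth_take 0 i4).
  by rewrite mem_nth // size_takel // size_tuple.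
have br i j : (0 < i < j)%N -> (j <= 13)%N -> x i \in U -> x j \in U ->
    bracket_table x i j \in U.
  by move=> ij j13 iU jU; rewrite -bracket_x //; apply/(subvP UU)/memv_bracket.
have x1 := xU 1%N isT; have x2 := xU 2%N isT.
have x3 := xU 3%N isT; have x4 := xU 4%N isT.
have x5 : x 5 \in U by apply: (br 1%N 2%N).
have x6 : x 6 \in U by apply: (br 1%N 4%N).
have x7 : x 7 \in U by apply: (br 2%N 3%N).
have x8 : x 8 \in U by apply: (br 2%N 4%N).
have x9 : x 9 \in U by apply: (br 3%N 8%N).
have x10 : x 10 \in U by apply: (br 1%N 6%N).
have x11 : x 11 \in U by apply: (br 1%N 7%N).
have x12 : x 12 \in U by apply: (br 1%N 8%N).
have x13 : x 13 \in U by apply: (br 2%N 5%N).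
apply/eqP; rewrite eqEsubv subvf -(span_basis Xb); apply/span_subvP => y.
case/(nthP 0) => i; rewrite size_tuple => i13 <-; rewrite -/(x i.+1).
by case: i i13 => [|[|[|[|[|[|[|[|[|[|[|[|[|i]]]]]]]]]]]]] // _.
Qed.

(** A subspace containing the derived algebra is a subalgebra, so a generating
    family has to span g together with the 9-dimensional derived algebra. *)
Lemma generators_ge4 (s : seq g) : lie_generates s -> (4 <= size s)%N.
Proof.
move=> gen_s; pose U := (<<s>> + <<drop 4 X>>)%VS.
have UT : U = fullv.
  apply: gen_s; first exact: subv_trans (gamma2_sub U U) (addvSr _ _).
  by move=> y ys; rewrite (subvP (addvSl _ _)) // memv_span.
have dU : (\dim U <= size s + 9)%N.
  apply: leq_trans (dimv_add_leqif _ _) _; apply: leq_add (dim_span _) _.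
  by apply: leq_trans (dim_span _) _; rewrite size_drop size_tuple.
have dX : \dim U = 13%N.
  by rewrite UT -(span_basis Xb) (eqP (basis_free Xb)) size_tuple.
by move: dU; rewrite dX -[13%N]/(4 + 9)%N leq_add2r.
Qed.

Lemma on_generators13 : on_generators g 4.
Proof.
split; last exact: generators_ge4.
by exists (take 4 X); [rewrite size_takel // size_tuple | exact: generated4].
Qed.

(** * Derivations *)

Lemma eq_from_diff (a b l r : k) : l = r -> a - b = l - r -> a = b.
Proof. by move=> ->; rewrite subrr => /eqP; rewrite subr_eq0 => /eqP. Qed.

Section Derivations.
Variable D : {linear g -> g}.
Hypothesis DD : derivation D.

Lemma derivation_table i j l : (0 < i < j)%N -> (j <= 13)%N ->
  c l (D (bracket_table x i j)) =
  c l (bracket (D (x i)) (x j)) + c l (bracket (x i) (D (x j))).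
Proof. by case: gX => _ XT ij j13; rewrite -XT // DD linearD. Qed.

(* derive i j l proves what D [x_i, x_j] = [D x_i, x_j] + [x_i, D x_j] says
   about the coordinate on x_l. *)
Local Ltac derive i j l :=
  let e := fresh "e" in
  have := @derivation_table i j l isT isT;
  rewrite ?coord_bracket /minor /= ?coord_x //= ?linear0 ?linearN ?linearD /=;
  move=> e; first [apply: (eq_from_diff e); ring
                  |apply: (eq_from_diff (esym e)); ring].

(** Write dij for the coordinate of D x_j on x_i. The factor 2 is cancelled
    because d23, d31 and d14 only come out as dij + dij = 0. *)
Lemma derivation_mod_gamma2 : 2%:R != 0 :> k ->
  (forall i j, (0 < i <= 4)%N -> (0 < j <= 4)%N -> i != j -> c i (D (x j)) = 0)
  /\ c 1 (D (x 1)) = c 3 (D (x 3)) /\ c 2 (D (x 2)) = c 4 (D (x 4)).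
Proof.
move=> two_neq0.
have double_eq0 (a : k) : a + a = 0 -> a = 0.
  by move/eqP; rewrite -mulr2n -mulr_natl mulf_eq0 (negPf two_neq0) => /eqP.
have d43 : c 4 (D (x 3)) = 0 by derive 1%N 3%N 6%N.
have d21 : c 2 (D (x 1)) = 0 by derive 1%N 3%N 7%N.
have d41 : c 4 (D (x 1)) = - c 2 (D (x 3)) by derive 1%N 3%N 5%N.
have d75 : c 7 (D (x 5)) = - c 3 (D (x 1)) by derive 1%N 2%N 7%N.
have d85 : c 8 (D (x 5)) = - c 4 (D (x 1)) by derive 1%N 2%N 8%N.
have d65 : c 6 (D (x 5)) = 0 by derive 1%N 5%N 10%N.
have d23 : c 2 (D (x 3)) = 0.
  apply: double_eq0; rewrite -{1}[c 2 _]opprK -d41 -d85; derive 3%N 4%N 8%N.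
have d42 : c 4 (D (x 2)) = 0 by rewrite -d65; derive 1%N 2%N 6%N.
have d13 : c 1 (D (x 3)) = 0.
  by apply: oppr_inj; rewrite oppr0 -d65; derive 3%N 4%N 6%N.
have d31 : c 3 (D (x 1)) = 0.
  apply: double_eq0; rewrite -{1}[c 3 _]opprK -d75; derive 1%N 5%N 11%N.
have d24 : c 2 (D (x 4)) = 0.
  rewrite -oppr0 -d31 -d75; derive 3%N 4%N 7%N.
have d12 : c 1 (D (x 2)) = 0 by derive 2%N 6%N 10%N.
have d32 : c 3 (D (x 2)) = 0.
  apply: oppr_inj; rewrite oppr0.
  have <- : c 11 (D (x 13)) = - c 3 (D (x 2)) by derive 2%N 5%N 11%N.
  by rewrite -d12; derive 2%N 7%N 11%N.
have d34 : c 3 (D (x 4)) = 0.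
  have <- : c 7 (D (x 8)) = c 3 (D (x 4)) by derive 2%N 4%N 7%N.
  by derive 4%N 8%N 13%N.
have d14 : c 1 (D (x 4)) = 0.
  have e : c 5 (D (x 8)) = - c 1 (D (x 4)) - c 3 (D (x 2)).
    by derive 2%N 4%N 5%N.
  rewrite d32 subr0 in e.
  apply: double_eq0; rewrite -{1}[c 1 _]opprK -e; derive 4%N 8%N 12%N.
have d55 : c 5 (D (x 5)) = c 1 (D (x 1)) + c 2 (D (x 2)) by derive 1%N 2%N 5%N.
have d57 : c 5 (D (x 7)) = c 4 (D (x 2)) - c 1 (D (x 3)) by derive 2%N 3%N 5%N.
have d77 : c 7 (D (x 7)) = c 2 (D (x 2)) + c 3 (D (x 3)) by derive 2%N 3%N 7%N.
have d11 : c 1 (D (x 1)) = c 3 (D (x 3)).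
  have e : c 13 (D (x 13)) = c 2 (D (x 2)) + c 5 (D (x 5)) + c 7 (D (x 5)).
    by derive 2%N 5%N 13%N.
  have : c 13 (D (x 13)) =
      c 2 (D (x 2)) + c 4 (D (x 2)) + c 5 (D (x 7)) + c 7 (D (x 7)).
    by derive 2%N 7%N 13%N.
  rewrite e d55 d75 d57 d77 d31 d42 d13 => f; apply: (eq_from_diff f); ring.
have d22 : c 2 (D (x 2)) = c 4 (D (x 4)).
  have : c 5 (D (x 5)) = c 3 (D (x 3)) + c 4 (D (x 4)) by derive 3%N 4%N 5%N.
  by rewrite d55 d11 => /addrI.
split=> //; rewrite d23 oppr0 in d41.
by case=> [|[|[|[|[|i]]]]] // [|[|[|[|[|j]]]]].
Qed.

(** Each of these relations compares coordinates of the same degree, so the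
    degree 1 part of D obeys them whatever its part of degree 0 is. *)
Lemma derivation_degree1 :
  [/\ c 7 (D (x 1)) = 0 /\ c 8 (D (x 1)) = 0,
      c 5 (D (x 1)) = - c 7 (D (x 3)), c 8 (D (x 4)) = c 7 (D (x 3)),
      c 5 (D (x 4)) = c 7 (D (x 2)) & c 5 (D (x 3)) = - c 8 (D (x 2))].
Proof.
have d81 : c 8 (D (x 1)) = 0 by derive 1%N 3%N 9%N.
have d63 : c 6 (D (x 3)) = 0 by derive 1%N 3%N 10%N.
have d51 : c 5 (D (x 1)) = - c 7 (D (x 3)) by derive 1%N 3%N 11%N.
have e13 : c 13 (D (x 5)) = - c 5 (D (x 1)) - c 7 (D (x 1)).
  by derive 1%N 2%N 13%N.
have e11 : c 11 (D (x 5)) = c 7 (D (x 2)) by derive 1%N 2%N 11%N.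
have e12 : c 12 (D (x 5)) = c 8 (D (x 2)) by derive 1%N 2%N 12%N.
have e9 : c 9 (D (x 5)) = 0 by derive 1%N 2%N 9%N.
have f13 : c 13 (D (x 5)) = c 7 (D (x 3)) by derive 3%N 4%N 13%N.
have d71 : c 7 (D (x 1)) = 0.
  apply: oppr_inj; apply: (addrI (- c 5 (D (x 1)))).
  by rewrite -e13 f13 d51; ring.
split=> //.
- have : c 9 (D (x 5)) = c 6 (D (x 3)) + c 7 (D (x 3)) - c 8 (D (x 4)).
    by derive 3%N 4%N 9%N.
  by rewrite e9 d63 add0r => /esym /subr0_eq.
- by rewrite -e11; derive 3%N 4%N 11%N.
- by rewrite -e12; derive 3%N 4%N 12%N.
Qed.

(** On [g, g] such a D acts through V2 -> V3; the coordinate on x13 is computed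
    from x5 = [x1, x2], x7 = [x2, x3], x8 = [x2, x4] and the relations of degree
    1, while x6 and V3 contribute nothing. *)
Lemma derivation_coord13 u :
  (forall i j, (0 < i <= 4)%N -> (0 < j <= 4)%N -> c i (D (x j)) = 0) ->
  (forall l, (0 < l <= 4)%N -> c l u = 0) ->
  c 13 (D u) = c 5 u * c 7 (D (x 3)) + c 8 u * c 7 (D (x 4))
               + c 7 u * (c 7 (D (x 3)) + c 5 (D (x 3))).
Proof.
move=> D_gamma2; have [[d71 d81] d51 d84 d54 d53] := derivation_degree1.
have e5 : c 13 (D (x 5)) = c 7 (D (x 3)).
  have -> : c 13 (D (x 5)) = - c 5 (D (x 1)) - c 7 (D (x 1)).
    by derive 1%N 2%N 13%N.
  by rewrite d51 d71 opprK subr0.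
have e6 : c 13 (D (x 6)) = 0 by rewrite -oppr0 -d71; derive 1%N 4%N 13%N.
have e7 : c 13 (D (x 7)) = c 7 (D (x 3)) + c 5 (D (x 3)).
  by derive 2%N 3%N 13%N.
have e8 : c 13 (D (x 8)) = c 7 (D (x 4)).
  have -> : c 13 (D (x 8)) = c 5 (D (x 4)) + c 7 (D (x 4)) - c 7 (D (x 2)).
    by derive 2%N 4%N 13%N.
  by rewrite d54; ring.
have e9 : c 13 (D (x 9)) = 0 by derive 3%N 8%N 13%N.
have e10 : c 13 (D (x 10)) = 0 by derive 1%N 6%N 13%N.
have e11 : c 13 (D (x 11)) = 0.
  have -> : c 13 (D (x 11)) = c 2 (D (x 1)) + c 4 (D (x 1)).
    by derive 1%N 7%N 13%N.
  by rewrite !D_gamma2 // addr0.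
have e12 : c 13 (D (x 12)) = 0 by derive 1%N 8%N 13%N.
have e13 : c 13 (D (x 13)) = 0.
  have -> : c 13 (D (x 13)) = c 2 (D (x 2)) + c 5 (D (x 5)) + c 7 (D (x 5)).
    by derive 2%N 5%N 13%N.
  have -> : c 5 (D (x 5)) = c 1 (D (x 1)) + c 2 (D (x 2)) by derive 1%N 2%N 5%N.
  have -> : c 7 (D (x 5)) = - c 3 (D (x 1)) by derive 1%N 2%N 7%N.
  by rewrite !D_gamma2 // oppr0 !addr0.
move=> u0.
rewrite {1}(coord_basis Xb (memvf u)) !raddf_sum /=.
pose F i := c i.+1 u * c 13 (D (x i.+1)).
rewrite (eq_bigr (fun i : 'I_13 => F i)) => [|i _].
  rewrite -(big_mkord xpredT F) /index_iota /= !big_cons big_nil /F.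
  rewrite (u0 1%N) // (u0 2%N) // (u0 3%N) // (u0 4%N) //.
  by rewrite e5 e6 e7 e8 e9 e10 e11 e12 e13; ring.
by rewrite !linearZ /F /xcoord /= inord_val.
Qed.
End Derivations.

(** * LR-structures *)

Local Ltac bracket_coord :=
  rewrite coord_bracket /minor !coord_x //=; ring.

(** A derivation L_u only rescales x1, .., x4 modulo [g, g], so x_i . x_j and
    x_j . x_i, which agree there, vanish when i != j. The eigenvalues being
    equal in pairs, this settles x_i . x_i too. *)
Lemma LR_product_in_gamma2 (m : {bilinear g -> g -> g}) :
  2%:R != 0 :> k -> is_LR_structure m ->
  forall l i j, (0 < l <= 4)%N -> (0 < i <= 4)%N -> (0 < j <= 4)%N ->
  c l (m (x i) (x j)) = 0.
Proof.
move=> two_neq0 LR; have [_ _ mB] := LR.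
have Z i := derivation_mod_gamma2 (LR_derivation LR (x i)) two_neq0.
have com l i j : (0 < l <= 4)%N -> c l (m (x i) (x j)) = c l (m (x j) (x i)).
  move=> l4; apply/eqP; rewrite -subr_eq0 -linearB -mB /=.
  by case: l l4 => [|[|[|[|[|l]]]]] // _; rewrite coord_bracket.
have off l i j : (0 < l <= 4)%N -> (0 < i <= 4)%N -> (0 < j <= 4)%N ->
    i != j -> c l (m (x i) (x j)) = 0.
  move=> l4 i4 j4 ij; have [lj | lj] := eqVneq l j; last exact: (Z i).1.
  by rewrite com // (Z j).1 // lj eq_sym.
move=> l i j l4 i4 j4; have [ij | ij] := eqVneq i j; last exact: off.
have [li | li] := eqVneq l i; last by apply: (Z i).1 => //; rewrite -ij.
(* The coefficient of x_i in x_i . x_i equals that of x_j in x_i . x_j, where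
   {i, j} is {1, 3} or {2, 4}. *)
rewrite li -ij {l li j ij j4 l4}.
by case: i i4 => [|[|[|[|[|i]]]]] // _;
  first [rewrite (Z _).2.1 | rewrite -(Z _).2.1
        |rewrite (Z _).2.2 | rewrite -(Z _).2.2]; exact: off.
Qed.

Lemma no_LR_structure : 2%:R != 0 :> k -> ~ admits_LR_structure g.
Proof.
move=> two_neq0 [m LR]; have [mL _ mB] := LR.
have G2 := LR_product_in_gamma2 two_neq0 LR.
have DD i := LR_derivation LR (x i).
have G i (i4 : (0 < i <= 4)%N) l j (l4 : (0 < l <= 4)%N) := G2 l i j l4 i4.
have R i := derivation_degree1 (DD i).
have [_ _ _ _ r135] := R 1%N.
have [[r217 r218] r215 r248 _ _] := R 2%N.
have [[r317 _] _ _ r345 _] := R 3%N.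
have [[r417 _] _ _ _ r435] := R 4%N.
have skew l i j (e : k) : c l (bracket (x i) (x j)) = e ->
    c l (m (x i) (x j)) = c l (m (x j) (x i)) + e.
  by move=> <-; rewrite mB linearB /= addrC subrK.
(* [rijl] comes from the derivation L_{x_i}, [sijl] from the antisymmetry
   equation for x_i and x_j. *)
have s125 : c 5 (m (x 1) (x 2)) = c 5 (m (x 2) (x 1)) + 1.
  by apply: skew; bracket_coord.
have s127 : c 7 (m (x 1) (x 2)) = c 7 (m (x 2) (x 1)).
  by rewrite -[RHS]addr0; apply: skew; bracket_coord.
have s128 : c 8 (m (x 1) (x 2)) = c 8 (m (x 2) (x 1)).
  by rewrite -[RHS]addr0; apply: skew; bracket_coord.
have s137 : c 7 (m (x 1) (x 3)) = c 7 (m (x 3) (x 1)).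
  by rewrite -[RHS]addr0; apply: skew; bracket_coord.
have s147 : c 7 (m (x 1) (x 4)) = c 7 (m (x 4) (x 1)).
  by rewrite -[RHS]addr0; apply: skew; bracket_coord.
have s237 : c 7 (m (x 2) (x 3)) = c 7 (m (x 3) (x 2)) + 1.
  by apply: skew; bracket_coord.
have s345 : c 5 (m (x 3) (x 4)) = c 5 (m (x 4) (x 3)) - 1.
  by apply: skew; bracket_coord.
have s248 : c 8 (m (x 2) (x 4)) = c 8 (m (x 4) (x 2)) + 1.
  by apply: skew; bracket_coord.
pose a := c 7 (m (x 2) (x 3)).
have a2 : a + a = 1.
  have s42 : c 8 (m (x 4) (x 2)) = a - 1 by rewrite /a -r248 s248 addrK.
  by rewrite {1}/a s237 -r345 s345 r435 s42; ring.
have : c 13 (m (x 1) (m (x 2) (x 2))) = c 13 (m (x 2) (m (x 1) (x 2))).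
  by rewrite mL.
rewrite (derivation_coord13 (DD 1%N) (G 1%N isT));
  last by move=> l l4; exact: G2.
rewrite (derivation_coord13 (DD 2%N) (G 2%N isT));
  last by move=> l l4; exact: G2.
rewrite r135 s128 r218 s137 r317 s147 r417 s127 r217 s125 r215 -/a => e.
have : (1 - a) * a = 0 by apply: (eq_from_diff (esym e)); ring.
rewrite -a2 addrK => /eqP; rewrite mulf_eq0 orbb => /eqP a0.
by have /eqP := oner_neq0 k; rewrite -a2 a0 addr0.
Qed.

End Coordinates.

Theorem proposition4p7 (k : fieldType) (k_char0 : [pchar k] =i pred0)
    (g : lieAlgType k) (X : 13.-tuple g) (gX : has_bracket_table X) :
  [/\ step_nilpotent g 3, on_generators g 4, two_step_solvable g
    & ~ admits_LR_structure g].
Proof.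
have two_neq0 : 2%:R != 0 :> k by have /negbT := k_char0 2%N; rewrite inE.
split.
- exact: step_nilpotent13 gX.
- exact: on_generators13 gX.
- exact: two_step_solvable13 gX.
- exact: no_LR_structure gX two_neq0.
Qed.
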